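(* Let $X$ be a nonempty Tychonoff space. The following are equivalent. (a) Two has a winning strategy in $G_1(\mathcal N[K(X)],\neg\mathcal K_X)$. (b) Two has a winning Markov strategy in $G_1(\mathcal N[K(X)],\neg\mathcal K_X)$. (c) One has a winning strategy in $G_1(\mathcal K_X,\mathcal K_X)$. (d) $X$ fails $S_1(\mathcal K_X,\mathcal K_X)$, that is, One has a winning predetermined strategy in $G_1(\mathcal K_X,\mathcal K_X)$. (e) One has a winning strategy in $G_1(\Omega_{C_k(X),\mathbf 0},\Omega_{C_k(X),\mathbf 0})$. (f) $C_k(X)$ does not have strong countable fan tightness, that is, One has a winning predetermined strategy in $G_1(\Omega_{C_k(X),\mathbf 0},\Omega_{C_k(X),\mathbf 0})$. (g) One has a winning strategy in $G_1(\mathcal D_{C_k(X)},\Omega_{C_k(X),\mathbf 0})$. (h) $C_k(X)$ does not have strong countable dense fan tightness, that is, One has a winning predetermined strategy in $G_1(\mathcal D_{C_k(X)},\Omega_{C_k(X),\mathbf 0})$. (i) Two has a winning strategy in $G_1(\mathcal N_{\mathbf 0},\neg\Omega_{C_k(X),\mathbf 0})$. (j) Two has a winning Markov strategy in $G_1(\mathcal N_{\mathbf 0},\neg\Omega_{C_k(X),\mathbf 0})$. (k) Two has a winning strategy in $G_1(\mathcal T_{C_k(X)},\neg\Omega_{C_k(X),\mathbf 0})$. (l) Two has a winning Markov strategy in $G_1(\mathcal T_{C_k(X)},\neg\Omega_{C_k(X),\mathbf 0})$. (m) Two has a winning strategy in $G_1(\mathcal T_{C_k(X)},CD_{C_k(X)})$.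 (n) Two has a winning Markov strategy in $G_1(\mathcal T_{C_k(X)},CD_{C_k(X)})$.
   Context: Spaces. $C_k(X)$ is the set of continuous functions $X\to\mathbb R$ with the topology of uniform convergence on compact subsets of $X$ (the compact-open topology); $\mathbf 0$ is the zero function. $K(X)$ is the family of nonempty compact subsets of $X$. Covers. An open cover of $X$ is a collection $\mathcal U$ of open sets with $\bigcup\mathcal U=X$ and $X\notin\mathcal U$ (all open covers are nontrivial). A $k$-cover is an open cover $\mathcal U$ such that every compact $K\subseteq X$ is contained in some $U\in\mathcal U$. $\mathcal K_X$ is the collection of all $k$-covers of $X$. For $A\subseteq X$, $\mathcal N(A)$ is the set of open $U\subsetneq X$ with $A\subseteq U$, and $\mathcal N[K(X)]=\{\mathcal N(K):K\in K(X)\}$; so in a game with first argument $\mathcal N[K(X)]$ One plays a compact set $K$ and Two answers with an open set $U\supseteq K$, $U\ne X$. Families in a space $Y$ with $y\in Y$. $\mathcal T_Y$: nonempty open subsets of $Y$. $\mathcal D_Y$: dense subsets of $Y$. $CD_Y$: closed and discrete subsets of $Y$. $\Omega_{Y,y}$: sets $A\subseteq Y$ with $y\in\overline{A}$. $\mathcal N_{\mathbf 0}$: all open neighborhoods of $\mathbf 0$ in $C_k(X)$. Selection principle. $S_1(\mathcal A,\mathcal B)$: for every sequence $(A_n)_{n\in\omega}$ of elements of $\mathcal A$ there are $B_n\in A_n$ ($n\in\omega$) with $\{B_n:n\in\omega\}\in\mathcal B$. A space $Y$ has strong countable fan tightness (resp. strong countable dense fan tightness) at $y$ if $S_1(\Omega_{Y,y},\Omega_{Y,y})$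 (resp. $S_1(\mathcal D_Y,\Omega_{Y,y})$) holds, and has the property if it has it at every point; since $C_k(X)$ is homogeneous, it suffices to consider $\mathbf 0$. Games. In $G_1(\mathcal A,\mathcal B)$, in each round $n\in\omega$ One plays $A_n\in\mathcal A$ and Two answers with $B_n\in A_n$; Two wins if $\{B_n:n\in\omega\}\in\mathcal B$, otherwise One wins. In $G_1(\mathcal A,\neg\mathcal B)$ Two wins if $\{B_n:n\in\omega\}\notin\mathcal B$, otherwise One wins. A player who has no legal move loses. A strategy (without qualifier) has perfect information: moves may depend on the whole history. A predetermined strategy for One is a function of the round number only; a Markov strategy for Two is a function of One's most recent move and the round number only. A strategy is winning if its owner wins every play in which it is followed. *)

(* Defs.v *)
From HB Require Import structures.
From mathcomp Require Import all_boot all_order all_algebra.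
From mathcomp Require Import all_classical all_reals all_analysis.
Import Order.TTheory GRing.Theory Num.Theory.
Import numFieldNormedType.Exports.

Set Implicit Arguments.
Unset Strict Implicit.
Unset Printing Implicit Defensive.

Local Open Scope classical_set_scope.
Local Open Scope ring_scope.

Section selection.
Context {M : Type}.
Implicit Types A B W : set (set M).

Definition S1 A B : Prop :=
  forall a : nat -> set M, (forall n, A (a n)) ->
  exists b : nat -> M, (forall n, a n (b n)) /\ B (range b).

(* The game with first argument A in which Two wins a play with answers b_n
   iff W (range b): G_1(A, B) is (A, B) and G_1(A, not B) is (A, ~` B).
   A strategy reads the opponent's moves so far, in chronological order; the
   owner's own earlier moves are determined by these and by the strategy.
   An infinite play in which One follows s is a sequence b of answers with
   b_n in s [:: b_0; ...; b_(n-1)]; when Two is stuck there is no such b and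
   One wins. For Two, membership of the answers in One's moves is part of the
   conclusion, so that Two cannot win with no legal move. *)

Definition one_wins A W : Prop :=
  exists s : seq M -> set M,
    (forall h, A (s h)) /\
    (forall b : nat -> M, (forall n, s (mkseq b n) (b n)) -> ~ W (range b)).

Definition one_wins_predetermined A W : Prop :=
  exists s : nat -> set M,
    (forall n, A (s n)) /\
    (forall b : nat -> M, (forall n, s n (b n)) -> ~ W (range b)).

Definition two_wins A W : Prop :=
  exists t : seq (set M) -> M,
    forall a : nat -> set M, (forall n, A (a n)) ->
    (forall n, a n (t (mkseq a n.+1))) /\
    W (range (fun n => t (mkseq a n.+1))).

Definition two_wins_markov A W : Prop :=
  exists t : set M -> nat -> M,
    forall a : nat -> set M, (forall n, A (a n)) ->
    (forall n, a n (t (a n) n)) /\ W (range (fun n => t (a n) n)).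

End selection.

Definition tychonoff_space (X : topologicalType) : Prop :=
  hausdorff_space X /\ completely_regular_space X.

Definition k_covers (X : topologicalType) : set (set (set X)) :=
  [set U | [/\ U `<=` open, \bigcup_(u in U) u = setT, ~ U setT &
    forall K : set X, compact K -> exists2 u, U u & K `<=` u]].

Arguments k_covers : clear implicits.

Definition proper_open_nbhs (X : topologicalType) (A : set X) : set (set X) :=
  [set U | [/\ open U, U != setT & A `<=` U]].

Definition NK (X : topologicalType) : set (set (set X)) :=
  [set proper_open_nbhs K | K in [set K : set X | compact K /\ K !=set0]].

Arguments NK : clear implicits.

Section families.
Context (Y : topologicalType).

Definition nonempty_opens : set (set Y) := [set U | open U /\ U !=set0].

Definition dense_sets : set (set Y) := [set D | dense D].

Definition closed_discrete_sets : set (set Y) :=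
  [set D | closed D /\ D `<=` isolated D].

Definition clusters_at (y : Y) : set (set Y) := [set A | closure A y].

Definition strong_countable_fan_tightness : Prop :=
  forall y : Y, S1 (clusters_at y) (clusters_at y).

Definition strong_countable_dense_fan_tightness : Prop :=
  forall y : Y, S1 dense_sets (clusters_at y).

End families.

Arguments nonempty_opens : clear implicits.
Arguments dense_sets : clear implicits.
Arguments closed_discrete_sets : clear implicits.

Definition Ck (R : realType) (X : topologicalType) : Type := continuousType X R.

HB.instance Definition _ (R : realType) (X : topologicalType) :=
  Choice.on (Ck R X).
HB.instance Definition _ (R : realType) (X : topologicalType) :=
  Topological.copy (Ck R X)
    (initial_topology
      (id : continuousType X R -> {family compact, X -> R})).

Definition Ck0 (R : realType) (X : topologicalType) : Ck R X :=
  cst (0 : R) : continuousType X R.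

(* Main.v *)
Require Import Defs.
From HB Require Import structures.
From mathcomp Require Import all_boot all_order all_algebra.
From mathcomp Require Import all_classical all_reals all_analysis.
Import Order.TTheory GRing.Theory Num.Theory.
Import numFieldNormedType.Exports.

Set Implicit Arguments.
Unset Strict Implicit.
Unset Printing Implicit Defensive.

Local Open Scope classical_set_scope.

(** The hub of the equivalence is the failure of S_1 for k-covers: every other
property implies it, and it implies every other property.

It implies the rest because of one construction.  Let U_n be k-covers such that
no selection u_n in U_n is a k-cover.  Since every compact K lies in some
element of U_n, Two may answer the neighbourhoods of K in round n from U_n, a
Markov strategy that never produces a k-cover ([one_wins_predetermined_dual]).
In the function space, let D_n be the set of functions equal to n + 1 off some
element of U_n.  Complete regularity makes D_n dense
([dense_eq_off_k_cover]).  If f_n in D_n is witnessed by u_n, then some compact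
K lies in no u_n, so that every f_n takes the value n + 1 on K.  A
neighbourhood of any function, given by K and radius 1, then contains only
finitely many f_n, and such a neighbourhood of 0 contains none
([escaping_sequence]).  Hence every selection is closed and discrete and stays
away from 0, which gives the winning Markov and predetermined strategies on the
side of C_k(X).

Conversely, every property gives One a winning strategy, with perfect
information, either on k-covers or on the sets clustering at 0: a winning
strategy of Two is turned around by letting One play the set of all answers that
the strategy may give next ([two_wins_dual]).  It remains to see that no such
strategy exists when S_1 holds for k-covers.  Let the compact subsets of X carry
the topology generated by the sets of all K contained in u, for u open in X.
Then S_1 for k-covers makes this hyperspace a Rothberger space
([S1_rothberger_compacts]), and a theorem of Pawlikowski
([pawlikowski]) says that in a Rothberger space any strategy of One is
defeated by a play covering every point infinitely often.  A strategy on
k-covers, or on sets of functions clustering at 0, becomes a strategy on open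
covers of the hyperspace once a set u is read as the set of all K contained in
u, and a function f, in round n, as the set of all K on which |f| < 1/(n + 1)
([rothberger_play]).  Infinite repetition is what lets the radii 1/(n + 1)
become arbitrarily small on every compact set.

Pawlikowski's theorem has two stages.  One's strategy is a tree of countable
open covers.  First, Two only bounds the index of the answer; a diagonal
argument in the style of Hurewicz finds bounds such that, at infinitely many
levels, a given point is covered at all nodes within the bounds at once
([rothberger_hurewicz]).  Then, among the finite intersections over these nodes
one is chosen at each level so that every point is still caught infinitely often
([rothberger_selection]); each choice has an index to play at every node, in
particular at the node actually reached. *)

(** * Plays, strategies and duality *)

(** Dependent choice along finite histories: it builds the plays below. *)
Lemma history_choice (T : Type) (Q : seq T -> T -> Prop) :
  (forall h, exists x, Q h x) -> exists b : nat -> T, forall n, Q (mkseq b n) (b n).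
Proof.
move=> /choice[F QF]; pose hist n := iter n (fun h => rcons h (F h)) [::].
exists (fun n => F (hist n)) => n.
suff -> : mkseq (fun n => F (hist n)) n = hist n by exact: QF.
by elim: n => // n IH; rewrite mkseqS IH.
Qed.

(** A strategy for One is carried to another game by labelling its legal moves,
with labels that may depend on the position.  A position of the new game is
decoded step by step, each label being replaced by some legal move that
carries it, and this is why every play of the new game lifts to the old one. *)
Lemma simulate (M N : Type) (s : seq M -> set M) (phi : seq M -> M -> N) :
  exists s' : seq N -> set N,
    (forall H, exists h, s' H = phi h @` s h) /\
    (forall b', (forall n, s' (mkseq b' n) (b' n)) ->
       exists b, forall n,
         s (mkseq b n) (b n) /\ b' n = phi (mkseq b n) (b n)).
Proof.
have [[m0]|M0] := pselect (inhabited M); last first.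
  exists (fun=> phi [::] @` s [::]); split; first by move=> _; exists [::].
  by move=> b' /(_ 0)[m]; case: M0.
have /choice[F FP] : forall hV : seq M * N, exists m,
    (phi hV.1 @` s hV.1) hV.2 -> s hV.1 m /\ phi hV.1 m = hV.2.
  move=> [h V]; have [[m sm mV]|nV] := pselect ((phi h @` s h) V).
    by exists m.
  by exists m0.
pose dec := foldl (fun h V => rcons h (F (h, V))) [::].
exists (fun H => phi (dec H) @` s (dec H)); split; first by move=> H; exists (dec H).
move=> b' b'P; exists (fun n => F (dec (mkseq b' n), b' n)).
have decE n : mkseq (fun n => F (dec (mkseq b' n), b' n)) n = dec (mkseq b' n).
  elim: n => // n IH; rewrite mkseqS IH.
  by rewrite mkseqS /dec foldl_rcons.
by move=> n; rewrite decE; have [? ->] := FP (_, _) (b'P n).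
Qed.

Section games.
Context {M : Type}.
Implicit Types A B W : set (set M).

Lemma markov_two_wins A W : two_wins_markov A W -> two_wins A W.
Proof.
move=> [t tP]; have [[a0]|noM] := pselect (inhabited (set M)); last first.
  by case: noM; split; exact: set0.
exists (fun h => t (last a0 h) (size h).-1) => a aA.
have E n : t (last a0 (mkseq a n.+1)) (size (mkseq a n.+1)).-1 = t (a n) n.
  by rewrite mkseqS last_rcons size_rcons size_mkseq.
by under eq_fun do rewrite E; have [tin tW] := tP a aA; split=> // n; rewrite E.
Qed.

Lemma predetermined_one_wins A W : one_wins_predetermined A W -> one_wins A W.
Proof.
move=> [s [sA sW]]; exists (s \o size); split; first by move=> h; exact: sA.
by move=> b bs; apply: sW => n; have /= := bs n; rewrite size_mkseq.
Qed.

Lemma not_S1P A W : ~ S1 A W <-> one_wins_predetermined A W.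
Proof.
split=> [/existsNP[s /not_implyP[sA]]|[s [sA sW]] /(_ s sA)[b [bs]]]; last exact: sW.
by move=> /forallNP nW; exists s; split=> // b bs Wb; apply: (nW b).
Qed.

Lemma one_winsS A A' W : A `<=` A' -> one_wins A W -> one_wins A' W.
Proof. by move=> AA' [s [sA sW]]; exists s; split=> // h; apply/AA'/sA. Qed.

Lemma one_wins_predeterminedS A A' W : A `<=` A' ->
  one_wins_predetermined A W -> one_wins_predetermined A' W.
Proof. by move=> AA' [s [sA sW]]; exists s; split=> // h; apply/AA'/sA. Qed.

Lemma two_winsS A A' W : A `<=` A' -> two_wins A' W -> two_wins A W.
Proof. by move=> AA' [t tP]; exists t => a aA; apply: tP => n; exact/AA'/aA. Qed.

Lemma two_wins_markovS A A' W : A `<=` A' ->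
  two_wins_markov A' W -> two_wins_markov A W.
Proof. by move=> AA' [t tP]; exists t => a aA; apply: tP => n; exact/AA'/aA. Qed.

(** One offers all answers that Two's winning strategy may give to a legal next
move.  Whatever is picked from this set is the answer to some legal move, and a
whole play is therefore a play of Two's strategy.  Working with histories in
the subtype of legal moves keeps the decoding legal. *)
Lemma two_wins_dual A B W :
  (forall f : set M -> M, (forall a, A a -> a (f a)) -> B (f @` A)) ->
  two_wins A (~` W) -> one_wins B W.
Proof.
move=> AB [t tP].
have ext (a : nat -> {a | A a}) n :
    sval (a n) (t (rcons (map sval (mkseq a n)) (sval (a n)))).
  have [|/(_ n) + _] := tP (fun n => sval (a n)); first by move=> k; exact: svalP.
  by rewrite mkseqS /mkseq -map_comp.
have [s [sP splay]] := simulate (fun h : seq {a | A a} => setT)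
  (fun h a => t (rcons (map sval h) (sval a))).
exists s; split=> [H|b bs].
  have [h ->] := sP H.
  have legal (a : {a | A a}) : sval a (t (rcons (map sval h) (sval a))).
    have := ext (nth a (rcons h a)) (size h); rewrite nth_rcons ltnn eqxx.
    suff -> : mkseq (nth a (rcons h a)) (size h) = h by [].
    rewrite -[RHS](mkseq_nth a); apply/eq_in_map => i; rewrite mem_iota => /= ih.
    by rewrite nth_rcons ih.
  pose f := fun a => t (rcons (map sval h) a).
  have -> : [set t (rcons (map sval h) (sval a)) | a in [set: {a | A a}]] = f @` A.
    apply/seteqP; split=> _ [a Aa <-]; first by exists (sval a) => //; exact: svalP.
    by exists (exist _ a Aa).
  by apply: AB => a Aa; exact: legal (exist _ a Aa).
have [a aP] := splay b bs; have [_] := tP (fun n => sval (a n)) (fun n => svalP _).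
have -> // : (fun n => t (mkseq (fun n => sval (a n)) n.+1)) = b.
by apply/funext => n; have [_ ->] := aP n; rewrite mkseqS /mkseq -map_comp.
Qed.

(** Two answers in round n from the n-th set of the predetermined strategy, which
meets whatever One plays. *)
Lemma one_wins_predetermined_dual A B W : A !=set0 ->
  (forall a b, A a -> B b -> a `&` b !=set0) ->
  one_wins_predetermined B (~` W) -> two_wins_markov A W.
Proof.
move=> [a0 Aa0] AB [s [sB sW]]; have [m0 _] := AB _ _ Aa0 (sB 0).
have /choice[f fP] : forall an : set M * nat, exists m,
    A an.1 -> (an.1 `&` s an.2) m.
  move=> [a n]; have [Aa|nA] := pselect (A a); last by exists m0.
  by have [m ?] := AB _ _ Aa (sB n); exists m.
exists (fun a n => f (a, n)) => a aA; split=> [n|].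
  by have [] := fP (a n, n) (aA n).
by apply: contrapT => /(sW _); apply => n; have [] := fP (a n, n) (aA n).
Qed.
End games.

(** * The Rothberger game *)

Section rothberger.
Context {P : topologicalType}.

Definition open_covers : set (set (set P)) :=
  [set C | C `<=` open /\ forall x, exists2 V, C V & V x].

Definition rothberger := S1 open_covers open_covers.

Lemma open_bigcap_seq (I : eqType) (s : seq I) (F : I -> set P) :
  (forall i, i \in s -> open (F i)) -> open (\bigcap_(i in [set` s]) F i).
Proof.
elim: s => [_|i s IH oF].
  rewrite (_ : \bigcap_(_ in _) _ = setT); first exact: openT.
  by apply/seteqP; split=> // x _ j.
rewrite (_ : \bigcap_(_ in _) _ = F i `&` \bigcap_(j in [set` s]) F j).
  apply: openI; first by apply: oF; rewrite mem_head.
  by apply: IH => j js; apply: oF; rewrite inE js orbT.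
apply/seteqP; split=> x /=.
  move=> Fx; split=> [|j js]; apply: Fx => /=; first by rewrite mem_head.
  by rewrite inE js orbT.
by move=> [Fix Fx] j /=; rewrite inE => /orP[/eqP->//|]; exact: Fx.
Qed.

Lemma rothberger_select (C : nat -> set (set P)) : rothberger ->
  (forall n V, C n V -> open V) -> (forall n x, exists2 V, C n V & V x) ->
  exists b, (forall n, C n (b n)) /\ forall x, exists n, b n x.
Proof.
move=> roth oC cC; have [n|b [bC [_ bc]]] := roth C; first by split=> // V /oC.
by exists b; split=> // x; have [_ [n _ <-] ?] := bc x; exists n.
Qed.

Lemma rothberger_menger (W : nat -> nat -> set P) : rothberger ->
  (forall n m, open (W n m)) -> (forall n x, exists m, W n m x) ->
  exists f, forall x, exists n, W n (f n) x.
Proof.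
move=> roth oW cW.
have [n V [m _ <-]//|n x|b [bW bc]] :=
  rothberger_select (C := fun n => range (W n)) roth.
  by have [m Wx] := cW n x; exists (W n m) => //; exists m.
have /choice[f fP] n : exists m, W n m = b n by have [m _ <-] := bW n; exists m.
by exists f => x; have [n bx] := bc x; exists n; rewrite fP.
Qed.

(** Here [acc t] is the part of the space that Two has accumulated at node [t].
One increasing cover works for all nodes of level [n] at once, although there
are infinitely many of them: the nodes extending [:: k] with [m <= k] impose
nothing new on [W m], because [acc [:: m]] is already below [acc [:: k]], and
only the finitely many [k < m] remain. *)
Lemma tree_minorant (n : nat) (acc : seq nat -> set P) :
  (forall t, open (acc t)) ->
  (forall t m, acc t `<=` acc (rcons t m)) ->
  (forall t m m', (m <= m')%N -> acc (rcons t m) `<=` acc (rcons t m')) ->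
  (forall t x, exists m, acc (rcons t m) x) ->
  exists W : nat -> set P,
    [/\ forall m, open (W m),
        forall m m', (m <= m')%N -> W m `<=` W m',
        forall x, exists m, W m x &
        forall t m, size t = n -> W m `<=` acc (rcons t m)].
Proof.
elim: n acc => [|n IH] acc oacc grow mono cover.
  exists (fun m => acc [:: m]); split=> //; first by move=> m m'; exact: mono [::] _ _.
    by move=> x; exact: cover [::] x.
  by move=> t m /size0nil ->.
have /choice[Wk WkP] k := IH (fun t => acc (k :: t)) (fun t => oacc _)
  (fun t => grow (k :: t)) (fun t => mono (k :: t)) (fun t => cover (k :: t)).
exists (fun m => acc [:: m] `&`
  \bigcap_(k in [set` iota 0 m]) (Wk k m `|` acc [:: k])); split=> [m|m m' mm' x|x|].
- apply: openI => //; apply: open_bigcap_seq => k _; apply: openU => //.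
  by have [+ _ _ _] := WkP k; apply.
- move=> [accx Wx]; have accx' : acc [:: m'] x by exact: mono [::] _ _ mm' _ accx.
  split=> // k /=; rewrite mem_iota => /= km'.
  have [km|mk] := ltnP k m; last by right; exact: mono [::] _ _ mk _ accx.
  have [|Wkx|] := Wx k; first by rewrite /= mem_iota.
    by left; have [_ + _ _] := WkP k; apply; first exact: mm'.
  by right.
- have [k0 acck0] := cover [::] x.
  have /choice[g gP] k : exists m, Wk k m x by have [_ _ + _] := WkP k; apply.
  pose m := maxn k0 (\max_(k < k0) g k).
  have k0m : (k0 <= m)%N by exact: leq_maxl.
  exists m; split; first exact: mono [::] _ _ k0m _ acck0.
  move=> k /= _; have [kk0|k0k] := ltnP k k0; last first.
    by right; exact: mono [::] _ _ k0k _ acck0.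
  left; have [_ + _ _] := WkP k; apply; last exact: gP.
  by rewrite leq_max (leq_bigmax (Ordinal kk0)) orbT.
- move=> [//|k t] m [tn] x [accx Wx].
  have gr s : acc [:: k] x -> acc (k :: s) x.
    by elim/last_ind: s => // s i IHs /IHs /grow; exact.
  have [km|mk] := ltnP k m; last by apply: gr; exact: mono [::] _ _ mk _ accx.
  have [|Wkx|acck] := Wx k; first by rewrite /= mem_iota.
    by have [_ _ _ +] := WkP k; apply.
  exact: gr (rcons t m) acck.
Qed.

(** For each [k], accumulate only the moves of index at least [k]; every level
still covers the space.  A single play that beats the resulting trees for all
[k] covers each point at moves of arbitrarily large index, hence infinitely
often. *)
Lemma rothberger_hurewicz (E : seq nat -> nat -> set P) : rothberger ->
  (forall t m, open (E t m)) ->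
  (forall t m m', (m <= m')%N -> E t m `<=` E t m') ->
  (forall t x, exists m, E t m x) ->
  exists f : nat -> nat, forall x N, exists2 n, (N <= n)%N & E (mkseq f n) (f n) x.
Proof.
move=> roth oE mono cover.
pose acc k (t : seq nat) :=
  \bigcup_(i in [set i | (i < size t)%N /\ (k <= nth 0 t i)%N]) E (take i t) (nth 0 t i).
have accE k t m : acc k (rcons t m) =
    acc k t `|` (if (k <= m)%N then E t m else set0).
  apply/seteqP; split=> x.
    move=> [i [/=]]; rewrite size_rcons ltnS leq_eqVlt => /predU1P[->|it].
      rewrite nth_rcons ltnn eqxx => -> .
      by rewrite -cats1 take_size_cat//; right.
    rewrite nth_rcons it -cats1 takel_cat ?(ltnW it)// => ki Ex.
    by left; exists i.
  move=> [[i [/= it ki] Ex]|].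
    exists i; rewrite /= ?nth_rcons ?size_rcons ?it; first by rewrite ltnS ltnW.
    by rewrite -cats1 takel_cat// ltnW.
  case: ifP => // km Ex; exists (size t); rewrite /= ?size_rcons ?nth_rcons ?ltnn ?eqxx //.
  by rewrite -cats1 take_size_cat.
have /choice[W WP] (kn : nat * nat) : exists W : nat -> set P,
    [/\ forall m, open (W m),
        forall m m', (m <= m')%N -> W m `<=` W m',
        forall x, exists m, W m x &
        forall t m, size t = kn.2 -> W m `<=` acc kn.1 (rcons t m)].
  case: kn => k n; apply: tree_minorant => /= [t|t m|t m m' mm'|t x].
  - by apply: bigcup_open => i _.
  - by rewrite accE; left.
  - rewrite !accE; apply: setUS; case: ifP => [km|_]; last exact: sub0set.
    by rewrite (leq_trans km mm'); exact: mono.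
  - have [m Ex] := cover t x; exists (maxn k m); rewrite accE leq_maxl; right.
    exact: (mono t m _ (leq_maxr _ _) x Ex).
(* Only the levels from k on are used for the k-th tree, so that level n has to
   respect just the finitely many bounds with k <= n. *)
have /choice[g gP] k : exists g, forall x, exists n, W (k, n + k)%N (g n) x.
  by apply: (rothberger_menger (W := fun n => W (k, n + k)%N)) => // n; have [? ? ? ?] := WP (k, n + k)%N.
pose f n := \max_(k < n.+1) g k (n - k)%N.
have often x k : exists2 i, (k <= f i)%N & E (mkseq f i) (f i) x.
  have [n Wx] := gP k x; have [_ Wmono _ Wacc] := WP (k, n + k)%N.
  have kn : (k < (n + k).+1)%N by rewrite ltnS leq_addl.
  have gf : (g k n <= f (n + k))%N.
    have := leq_bigmax (F := fun j : 'I__ => g j (n + k - j)%N) (Ordinal kn).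
    by rewrite /= addnK.
  have := Wacc (mkseq f (n + k)) _ (size_mkseq _ _) _ (Wmono _ _ gf _ Wx).
  rewrite -mkseqS => -[i []]; rewrite size_mkseq => ink.
  rewrite nth_mkseq// => kf.
  rewrite /mkseq -map_take take_iota (minn_idPl _) ?(ltnW ink)//.
  by exists i.
exists f => x N; have [i Ni Ex] := often x (\max_(j < N) f j).+1; exists i => //.
by rewrite leqNgt; apply: contraL Ni => iN; rewrite -leqNgt (leq_bigmax (Ordinal iN)).
Qed.

(** A greedy choice: when [t] is reached, [pickle t] values at most are taken. *)
Lemma injective_choice (T : countType) (idx : T -> seq nat) :
  (forall t, uniq (idx t)) -> (forall t, (pickle t < size (idx t))%N) ->
  exists k : T -> nat, injective k /\ forall t, k t \in idx t.
Proof.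
move=> uidx sidx.
have [h|k kP] := history_choice (T := nat) (Q := fun h k =>
  forall t, pickle_inv (size h) = Some t -> k \in idx t /\ k \notin h).
  case Et: (pickle_inv (size h)) => [t|]; last by exists 0.
  have st : pickle t = size h by have := @pickle_invK T (size h); rewrite Et.
  have : has [predC h] (idx t).
    rewrite -[has _ _]negbK -all_predC; apply/negP => /allP hidx.
    have := sidx t; rewrite st ltnNge uniq_leq_size// => i /hidx /=.
    by rewrite negbK.
  by move=> /hasP[i it ih]; exists i => _ [<-].
have {}kP t : k (pickle t) \in idx t /\ k (pickle t) \notin mkseq k (pickle t).
  by apply: kP; rewrite size_mkseq pickleK_inv.
exists (k \o pickle); split; last by move=> t; have [] := kP t.
have ne (t t' : T) : (pickle t < pickle t')%N -> k (pickle t) != k (pickle t').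
  move=> tt'; have [_] := kP t'; apply: contra => /eqP <-.
  by apply/mapP; exists (pickle t) => //; rewrite mem_iota.
move=> t t' /= /eqP E; apply: (pcan_inj (@pickleK T)).
by case: (ltngtP (pickle t) (pickle t')) => // /ne; rewrite ?E// eq_sym E.
Qed.

(** The families need not cover one at a time.  The intersections of [q] members
of [q] different families do form a cover, because each point is caught
infinitely often.  Selecting one such intersection for each [q] leaves, at each
[q], enough families to pick a fresh one from.  Using a separate sequence of
covers for each [j], made of families of index at least [j], preserves the
infinite repetition. *)
Lemma rothberger_selection (F : nat -> set (set P)) : rothberger ->
  (forall i V, F i V -> open V) -> (forall i, F i !=set0) ->
  (forall x N, exists2 i, (N <= i)%N & exists2 V, F i V & V x) ->
  exists v, (forall i, F i (v i)) /\ forall x N, exists2 i, (N <= i)%N & v i x.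
Proof.
move=> roth oF F0 often.
(* The size (pickle jn).+1 is what the greedy choice of distinct indices needs. *)
pose C (jn : nat * nat) := [set O | exists (idx : seq nat) (w : nat -> set P),
  [/\ uniq idx, size idx = (pickle jn).+1, all (leq jn.1) idx,
      forall i, F i (w i) & O = \bigcap_(i in [set` idx]) w i]].
have coverC jn x : exists2 O, C jn O & O x.
  have /choice[w wP] i : exists V, F i V /\ ((exists2 V, F i V & V x) -> V x).
    have [[V FV Vx]|nV] := pselect (exists2 V, F i V & V x); first by exists V.
    by have [V FV] := F0 i; exists V.
  have [idx [B [uidx sidx idxj idxw _]]] : exists (idx : seq nat) (B : nat),
      [/\ uniq idx, size idx = (pickle jn).+1, all (leq jn.1) idx,
          forall i, i \in idx -> w i x & all (fun i => i < B)%N idx].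
    elim: (pickle jn).+1 => [|s [idx [B [uidx sidx idxj idxw idxB]]]].
      by exists [::], 0.
    have [i] := often x (maxn jn.1 B); rewrite geq_max => /andP[ji Bi] Fi.
    exists (i :: idx), i.+1; split=> /=.
    - rewrite uidx andbT; apply/negP => /(allP idxB).
      by rewrite ltnNge Bi.
    - by rewrite sidx.
    - by rewrite ji.
    - move=> l; rewrite inE => /predU1P[->|/idxw//].
      by have [_] := wP i; apply.
    - rewrite ltnSn /=; apply/allP => l /(allP idxB) lB.
      by rewrite ltnS (leq_trans (ltnW lB)).
  exists (\bigcap_(i in [set` idx]) w i); last by move=> i /idxw.
  by exists idx, w; split=> // i; have [] := wP i.
have openC jn O : C jn O -> open O.
  move=> [idx [w [_ _ _ Fw ->]]]; apply: open_bigcap_seq => i _.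
  exact: oF (Fw i).
have /choice[pk pkP] j : exists pk, (forall n, C (j, n) (pk n)) /\
    forall x, exists n, pk n x.
  by apply: (rothberger_select (C := fun n => C (j, n))) => // n; exact: openC.
have /choice[iw iwP] (jn : nat * nat) : exists iw : seq nat * (nat -> set P),
    [/\ uniq iw.1, size iw.1 = (pickle jn).+1, all (leq jn.1) iw.1,
      forall i, F i (iw.2 i) & pk jn.1 jn.2 = \bigcap_(i in [set` iw.1]) iw.2 i].
  by case: jn => j n; have [/(_ n)[idx [w wP]] _] := pkP j; exists (idx, w).
have [jn|jn|k [kinj kidx]] := injective_choice (idx := fun jn => (iw jn).1).
- by have [] := iwP jn.
- by have [_ -> _ _ _] := iwP jn.
have /choice[v vP] i : exists V, F i V /\ forall jn, k jn = i -> V = (iw jn).2 i.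
  have [[jn kjn]|nk] := pselect (exists jn, k jn = i).
    exists ((iw jn).2 i); split; first by have [_ _ _ + _] := iwP jn; apply.
    by move=> jn'; rewrite -kjn => /kinj ->.
  by have [V FV] := F0 i; exists V; split=> // jn kjn; case: nk; exists jn.
exists v; split=> [i|x j]; first by have [] := vP i.
have [_ /(_ x)[n pkx]] := pkP j.
have [_ _ kj _ pkE] := iwP (j, n).
exists (k (j, n)); first exact: allP kj _ (kidx _).
have [_ /(_ _ erefl) ->] := vP (k (j, n)).
by move: pkx; rewrite [pk _ _]pkE; apply; exact: kidx.
Qed.

(** The bounds provided by [rothberger_hurewicz] leave finitely many positions at
each level.  An intersection of answers over all of them is contained in the
answer to play at the position actually reached, so it suffices to select one
intersection per level. *)
Theorem pawlikowski (s : seq (set P) -> set (set P)) : rothberger ->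
  (forall h, open_covers (s h)) ->
  exists b, (forall n, s (mkseq b n) (b n)) /\
    forall x N, exists2 n, (N <= n)%N & b n x.
Proof.
move=> roth sC.
have /choice[U UP] h : exists u : nat -> set P,
    (forall i, s h (u i)) /\ forall x, exists i, u i x.
  by have [oC cC] := sC h; apply: (rothberger_select (C := fun=> s h)) => // _; exact: oC.
have oU h i : open (U h i) by have [+ _] := sC h; apply; have [] := UP h.
(* L t lists the positions in which the n-th answer has index at most the n-th
   entry of t, and E t m is the union of all finite intersections, over these
   positions, of answers of index at most m. *)
pose L := foldl (fun l m => [seq rcons p (U p i) | p <- l, i <- iota 0 m.+1]) [:: [::]].
pose E t m := \bigcap_(p in [set` L t]) \bigcup_(i in [set i | (i <= m)%N]) U p i.
have [t m|t m m' mm'|t x|f fP] := rothberger_hurewicz (E := E) roth.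
- by apply: open_bigcap_seq => p _; exact: bigcup_open.
- move=> x Ex p /Ex[i /= im Ux]; exists i => //=; exact: leq_trans mm'.
- have /choice[g gP] p : exists i, U p i x by have [_] := UP p; apply.
  exists (\max_(p <- L t) g p) => p pL; exists (g p) => //=.
  exact: leq_bigmax_seq.
pose F n := [set V | exists2 g : seq (set P) -> nat, (forall p, (g p <= f n)%N) &
  V = \bigcap_(p in [set` L (mkseq f n)]) U p (g p)].
have [n V [g _ ->]|n|x N|v [vF vP]] := rothberger_selection (F := F) roth.
- exact: open_bigcap_seq.
- by exists (\bigcap_(p in [set` L (mkseq f n)]) U p 0); exists (fun=> 0).
- have [n Nn Ex] := fP x N; exists n => //.
  have /choice[g gP] p : exists i, (i <= f n)%N /\ (p \in L (mkseq f n) -> U p i x).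
    have [/Ex[i ifn Ux]|npL] := pselect (p \in L (mkseq f n)); first by exists i.
    by exists 0; split.
  exists (\bigcap_(p in [set` L (mkseq f n)]) U p (g p)).
    by exists g => // p; have [] := gP p.
  by move=> p pL; have [_] := gP p; apply.
have /choice[g gP] n : exists g : seq (set P) -> nat, (forall p, (g p <= f n)%N) /\
    v n = \bigcap_(p in [set` L (mkseq f n)]) U p (g p).
  by have [g gf vE] := vF n; exists g.
(* At the position h reached, the selected intersection lies in the answer of
   index g (size h) h. *)
have [h|b bP] := history_choice (Q := fun h V => V = U h (g (size h) h)).
  by eexists.
have bL n : mkseq b n \in L (mkseq f n).
  elim: n => [|n IH]; first by rewrite inE.
  rewrite mkseqS (mkseqS f) /L foldl_rcons; apply/allpairsP.
  exists (mkseq b n, g n (mkseq b n)); split; first exact: IH.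
    by rewrite mem_iota ltnS /=; have [+ _] := gP n; apply.
  by rewrite [in LHS]bP size_mkseq.
exists b; split=> [n|x N]; first by rewrite bP; have [+ _] := UP (mkseq b n); apply.
have [n Nn vx] := vP x N; exists n => //; rewrite bP size_mkseq.
by have [_ vE] := gP n; move: vx; rewrite vE; apply; exact: bL.
Qed.

End rothberger.
Arguments open_covers : clear implicits.
Arguments rothberger : clear implicits.

(** Brings [pawlikowski] to games whose moves are not themselves open sets of the
Rothberger space, or are so in a way that depends on the position. *)
Lemma rothberger_play (P : topologicalType) (M : Type) (s : seq M -> set M)
    (phi : seq M -> M -> set P) : rothberger P ->
  (forall h, open_covers P (phi h @` s h)) ->
  exists b, (forall n, s (mkseq b n) (b n)) /\
    forall x N, exists2 n, (N <= n)%N & phi (mkseq b n) (b n) x.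
Proof.
move=> roth sC; have [s' [s'E s'play]] := simulate s phi.
have [H|b' [/s'play[b bP] b'P]] := pawlikowski (s := s') roth.
  by have [h ->] := s'E H.
exists b; split=> [n|x N]; first by have [] := bP n.
by have [n Nn b'x] := b'P x N; exists n => //; have [_ <-] := bP n.
Qed.

(** * The hyperspace of compact sets *)

Definition compacts (X : topologicalType) : Type := {K : set X | compact K}.

Section compacts.
Context {X : topologicalType}.

(** The upper Vietoris topology on compact sets has the sets [contained u], for
[u] open, as a base.  A k-cover of [X] amounts to a cover of this hyperspace by
basic sets other than [contained setT]. *)
Definition contained (u : set X) : set (compacts X) := [set K | sval K `<=` u].

HB.instance Definition _ := gen_eqMixin (compacts X).
HB.instance Definition _ := gen_choiceMixin (compacts X).

Let contained_cover : \bigcup_(u in [set u | open u]) contained u = setT.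
Proof. by apply/seteqP; split=> // K _; exists setT => //; exact: openT. Qed.

Let contained_join (u v : set X) (K : compacts X) : open u -> open v ->
  contained u K -> contained v K ->
  exists w, [/\ open w, contained w K & contained w `<=` contained u `&` contained v].
Proof.
move=> ou ov Ku Kv; exists (u `&` v); split; first exact: openI.
  by move=> x Kx; split; [exact: Ku | exact: Kv].
by move=> L Luv; split=> x /Luv[].
Qed.

HB.instance Definition _ :=
  isBaseTopological.Build (compacts X) contained_cover contained_join.

Lemma open_contained (u : set X) : open u -> open (contained u).
Proof.
move=> ou; exists [set u]; first by move=> _ ->.
by rewrite bigcup_set1.
Qed.

Lemma open_compactsP (V : set (compacts X)) (K : compacts X) : open V -> V K ->
  exists u, [/\ open u, sval K `<=` u & contained u `<=` V].
Proof.
move=> [D Dop <-] [u Du Ku]; exists u; split=> //; first exact: Dop.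
by move=> L Lu; exists u.
Qed.

(** Singletons are compact, so that covering the points is automatic. *)
Lemma k_coversP (U : set (set X)) : k_covers X U <->
  ~ U setT /\ (forall u, U u -> open u) /\
  forall K, compact K -> exists2 u, U u & K `<=` u.
Proof.
split=> [[]//|[UT [oU cU]]]; split=> //; apply/seteqP; split=> // x _.
by have [u Uu /(_ x erefl)] := cU _ (@compact_set1 _ x); exists u.
Qed.

(** An open cover is refined by basic sets, which form a k-cover except that [X]
itself may be one of them.  If [X] is not compact, a point outside [K] can be
removed from it.  If [X] is compact there is no k-cover, but then [X] is a point
of the hyperspace whose only neighbourhood is the whole hyperspace. *)
Lemma S1_rothberger_compacts : accessible_space X ->
  S1 (k_covers X) (k_covers X) -> rothberger (compacts X).
Proof.
move=> T1 S1k C coverC.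
have [cX|ncX] := pselect (compact [set: X]).
  have /choice[b bP] n : exists V, C n V /\ forall K, V K.
    have [oC cC] := coverC n; have [V CV VX] := cC (exist _ setT cX).
    have [u [_ uT uV]] := open_compactsP (oC _ CV) VX.
    by exists V; split=> // K; apply: uV => x _; exact: uT.
  exists b; split=> [n|]; first by have [] := bP n.
  split=> [_ [n _ <-]|K]; first by have [oC _] := coverC n; apply: oC; have [] := bP n.
  by exists (b 0); [exists 0 | have [] := bP 0].
pose U n := [set u : set X | [/\ open u, u <> setT & exists2 V, C n V & contained u `<=` V]].
have kU n : k_covers X (U n).
  apply/k_coversP; split; [by move=> []|split=> [u []//|K cK]].
  have [oC cC] := coverC n; have [V CV VK] := cC (exist _ K cK).
  have [u [ou Ku uV]] := open_compactsP (oC _ CV) VK.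
  have [x Kx] : exists x, ~ K x.
    apply/existsNP => KT; apply: ncX; rewrite (_ : setT = K) //.
    by apply/seteqP; split=> // x _; exact: KT.
  exists (u `&` ~` [set x]).
    split; first by apply: openI => //; apply/closed_openC/accessible_closed_set1.
      by move=> /seteqP[_ /(_ x I)[_]]; exact.
    by exists V => // L Lu; apply: uV => y /Lu[].
  by move=> y Ky; split; [exact: Ku | move=> yx; apply: Kx; rewrite -yx].
have [u [uU /k_coversP[_ [_ ucover]]]] := S1k U kU.
have /choice[b bP] n : exists V, C n V /\ contained (u n) `<=` V.
  by have [_ _ [V]] := uU n; exists V.
exists b; split=> [n|]; first by have [] := bP n.
split=> [_ [n _ <-]|[K cK]]; first by have [oC _] := coverC n; apply: oC; have [] := bP n.
have [_ [n _ <-] Kun] := ucover K cK.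
by exists (b n); [exists n | have [_] := bP n; apply].
Qed.

Lemma rothberger_compacts_k_covers :
  rothberger (compacts X) -> ~ one_wins (k_covers X) (k_covers X).
Proof.
move=> roth [s [sk sW]].
have [h|b [bs bc]] := rothberger_play (s := s) (phi := fun=> contained) roth.
  have /k_coversP[_ [oU cU]] := sk h; split=> [_ [u /oU ou <-]|[K cK]].
    exact: open_contained.
  by have [u Uu Ku] := cU K cK; exists (contained u) => //; exists u.
apply: (sW b bs); apply/k_coversP; split=> [[n _ bT]|].
  by have /k_coversP[+ _] := sk (mkseq b n); apply; rewrite -bT.
split=> [_ [n _ <-]|K cK].
  by have /k_coversP[_ [+ _]] := sk (mkseq b n); apply.
by have [n _ Kb] := bc (exist _ K cK) 0; exists (b n) => //; exists n.
Qed.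

(** Answers to the neighbourhoods of all nonempty compact sets form a k-cover; a
singleton takes care of the empty compact set. *)
Lemma two_wins_NK_one_wins_k_covers : [set: X] !=set0 ->
  two_wins (NK X) (~` k_covers X) -> one_wins (k_covers X) (k_covers X).
Proof.
move=> [x0 _]; apply: two_wins_dual => f fP; apply/k_coversP; split.
  move=> [_ [K [cK K0] <-] fT].
  by have [|_ /eqP] := fP (proper_open_nbhs K); first by exists K.
split=> [_ [_ [K [cK K0] <-] <-]|K cK].
  by have [|] := fP (proper_open_nbhs K); first by exists K.
have [->|/set0P K0] := eqVneq K set0.
  exists (f (proper_open_nbhs [set x0])) => //.
  exists (proper_open_nbhs [set x0]) => //; exists [set x0] => //.
  by split=> //; [exact: compact_set1 | exists x0].
have NK : NK X (proper_open_nbhs K) by exists K.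
by exists (f (proper_open_nbhs K)); [exists (proper_open_nbhs K) | have [_ _] := fP _ NK].
Qed.

Lemma k_covers_markov_NK : [set: X] !=set0 ->
  one_wins_predetermined (k_covers X) (k_covers X) ->
  two_wins_markov (NK X) (~` k_covers X).
Proof.
move=> [x0 _] win; apply: (@one_wins_predetermined_dual _ _ (k_covers X)).
- exists (proper_open_nbhs [set x0]), [set x0] => //.
  by split; [exact: compact_set1 | exists x0].
- move=> _ U [K [cK K0] <-] /k_coversP[UT [oU cU]].
  have [u Uu Ku] := cU K cK; exists u; split=> //; split=> //; first exact: oU.
  by apply/eqP => uT; apply: UT; rewrite -uT.
- by rewrite setCK.
Qed.

End compacts.

(** * Continuous functions under the compact-open topology *)

Lemma locally_finite_closed_discrete (Y : topologicalType) (D : set Y) : accessible_space Y ->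
  (forall y : Y, exists2 V, nbhs y V & finite_set (V `&` D)) ->
  closed_discrete_sets Y D.
Proof.
move=> T1 fin.
have sep (y : Y) : exists2 V, nbhs y V & V `&` D `<=` [set y].
  have [V yV VD] := fin y; exists (V `\` ((V `&` D) `\ y)); last first.
    by move=> z [[Vz nz] Dz]; apply: contrapT => zy; exact: nz.
  apply: filterI => //; apply: open_nbhs_nbhs; split; last by case=> _; exact.
  by apply: closed_openC; move/accessible_finite_set_closed: T1; apply; exact: finite_setD.
split=> y Dy.
  have [V /Dy[z [Dz Vz]] VD] := sep y.
  by have <- : z = y by exact: VD.
split; first exact/mem_set.
have [V yV VD] := sep y; exists V => //; apply/seteqP; split=> // _ ->.
by split=> //; exact: nbhs_singleton.
Qed.

Section Ck.
Context {R : realType} {X : topologicalType}.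
Implicit Types f g : Ck R X.
Local Open Scope ring_scope.

(** The filter generated by the sets on the right converges to [f] uniformly on
every compact set, hence in the topology, so that it contains all
neighbourhoods; conversely each of these sets is a neighbourhood. *)
Lemma Ck_nbhsP f (A : set (Ck R X)) : nbhs f A <->
  exists K (e : R), [/\ compact K, 0 < e &
    [set g : Ck R X | forall x, K x -> `|f x - g x| < e] `<=` A].
Proof.
split=> [|[K [e [cK e0 KA]]]]; last first.
  apply: filterS KA _.
  have E : entourage [set xy : R * R | `|xy.1 - xy.2| < e].
    by rewrite -entourage_ballE; exists e.
  have := @initial_continuous _ _ (id : continuousType X R -> {family compact, X -> R}) f.
  by move/(_ _ (fam_nbhs _ E cK)).
pose B (Ke : set X * R) := [set g : X -> R | forall x, Ke.1 x -> `|f x - g x| < Ke.2].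
pose F := filter_from [set Ke : set X * R | compact Ke.1 /\ 0 < Ke.2] B.
have FF : Filter F.
  apply: filter_from_filter; first by exists (set0, 1); split => //=; exact: compact0.
  move=> [K e] [L d] /= [cK e0] [cL d0]; exists (K `|` L, Num.min e d).
    by split=> /=; [exact: compactU | rewrite lt_min e0].
  move=> g /= gB; split=> x Kx.
    by have /= := gB x (or_introl Kx); rewrite lt_min => /andP[].
  by have /= := gB x (or_intror Kx); rewrite lt_min => /andP[].
have Ff : {family compact, F --> (f : X -> R)}.
  apply/fam_cvgP => K cK U /uniform_nbhs[E [+ EU]].
  rewrite -entourage_ballE => -[e /= e0 eE].
  exists (K, e) => // g gB; apply: EU => x Kx; apply: eE; exact: gB.
move=> [_ [[V oV <-] Vf VA]].
have [[K e] [cK e0] KeV] := Ff V (open_nbhs_nbhs (conj oV Vf)).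
by exists K, e; split=> // g gB; apply: VA; exact: KeV.
Qed.

Lemma Ck_closureP (A : set (Ck R X)) f : closure A f <->
  forall K (e : R), compact K -> 0 < e ->
    exists2 g : Ck R X, A g & forall x, K x -> `|f x - g x| < e.
Proof.
split=> [clA K e cK e0|clA B /Ck_nbhsP[K [e [cK e0 KB]]]].
  have [|g [Ag gK]] := clA [set g : Ck R X | forall x, K x -> `|f x - g x| < e].
    by apply/Ck_nbhsP; exists K, e; split.
  by exists g.
by have [g Ag gK] := clA K e cK e0; exists g; split=> //; exact: KB.
Qed.

Lemma dense_closureP (Y : topologicalType) (D : set Y) :
  dense D <-> forall y, closure D y.
Proof.
split=> [dD y B|clD U [y Uy] oU].
  rewrite nbhsE => -[U [oU Uy] UB].
  have [|z [Uz Dz]] := dD U _ oU; first by exists y.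
  by exists z; split=> //; exact: UB.
by have [|z [Dz Uz]] := clD y U; [exact: open_nbhs_nbhs | exists z].
Qed.

Lemma Ck_accessible : accessible_space (Ck R X).
Proof.
move=> f g fg; have [x fgx] : exists x, f x <> g x.
  by apply/existsNP => fgE; move/eqP: fg; apply; exact/continuousEP.
pose V := [set h : Ck R X | forall y, [set x] y -> `|f y - h y| < `|f x - g x|].
have fV : nbhs f V.
  apply/Ck_nbhsP; exists [set x], `|f x - g x|; split=> //.
    exact: compact_set1.
  by rewrite normr_gt0 subr_eq0; apply/eqP.
exists V°; split; first exact: open_interior.
  exact/mem_set.
by apply/mem_set => /interior_subset /(_ x erefl); rewrite ltxx.
Qed.

(** A nonempty space carries small nonzero constants, and so 0 is not isolated. *)
Lemma nonempty_open_no0 (U : set (Ck R X)) : [set: X] !=set0 ->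
  nonempty_opens (Ck R X) U -> nonempty_opens (Ck R X) (U `\ Ck0 R X).
Proof.
move=> [x0 _] [oU [f Uf]]; split.
  apply: openI => //; apply: closed_openC.
  by apply: accessible_closed_set1; exact: Ck_accessible.
have [f0|f0] := pselect (f = Ck0 R X); last by exists f.
have /Ck_nbhsP[K [e [cK e0 KU]]] : nbhs f U by exact: open_nbhs_nbhs.
pose g : Ck R X := mkcts (@cst_continuous X R (e / 2)).
exists g; split.
  apply: KU => x _; rewrite f0 /= /cst sub0r normrN gtr0_norm ?divr_gt0//.
  by rewrite ltr_pdivrMr// ltr_pMr// ltr1n.
move=> g0; have : g x0 = Ck0 R X x0 by rewrite g0.
by move=> /eqP; rewrite /= /cst gt_eqF// divr_gt0.
Qed.

Definition Ck_add (h f : Ck R X) : Ck R X :=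
  mkcts (fun x => continuousD (@cts_fun _ _ (f : continuousType X R) x)
                              (@cts_fun _ _ (h : continuousType X R) x)).

Lemma Ck_addE (h f : Ck R X) x : Ck_add h f x = f x + h x.
Proof. by []. Qed.

Lemma closure_Ck_add (h f : Ck R X) (A : set (Ck R X)) :
  closure A f -> closure (Ck_add h @` A) (Ck_add h f).
Proof.
move=> /Ck_closureP clA; apply/Ck_closureP => K e cK e0.
have [g Ag gK] := clA K e cK e0; exists (Ck_add h g); first by exists g.
by move=> x Kx; rewrite !Ck_addE opprD addrACA subrr addr0; exact: gK.
Qed.

Definition Ck_opp f : Ck R X :=
  mkcts (fun x => continuousN (@cts_fun _ _ (f : continuousType X R) x)).

Lemma Ck_addK f : cancel (Ck_add (Ck_opp f)) (Ck_add f).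
Proof.
have hE x : Ck_opp f x = - f x by [].
by move=> g; apply/continuousEP => x; rewrite !Ck_addE hE subrK.
Qed.

Lemma Ck_addN f : Ck_add (Ck_opp f) f = Ck0 R X.
Proof.
have hE x : Ck_opp f x = - f x by [].
by apply/continuousEP => x; rewrite Ck_addE hE subrr.
Qed.

(** Consider the [0, 1]-valued continuous functions equal to 1 off [u], as a filter
base for the downward pointwise order; products show that it is directed.  Near
each point of [K] such functions are eventually below 1/2, hence, by
compactness, one of them is below 1/2 on all of [K].  Rescaling it and cutting
it off at 0 gives exact values. *)
Lemma completely_regular_compact_separation (K u : set X) :
  completely_regular_space X -> compact K -> open u -> K `<=` u ->
  exists2 p : X -> R, continuous p &
    (forall x, K x -> p x = 0) /\ (forall x, ~ u x -> p x = 1).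
Proof.
move=> crX cK ou Ku.
pose S := [set p : X -> R | [/\ continuous p, forall x, 0 <= p x <= 1 &
  forall x, ~ u x -> p x = 1]].
pose B (p : X -> R) := [set q | S q /\ forall x, q x <= p x].
have FF : Filter (filter_from S B).
  apply: filter_from_filter.
    exists (cst 1); split=> [|x|//]; first by move=> x; exact: cvg_cst.
    by rewrite /= ler01 lexx.
  move=> p q [cp p01 pu] [cq q01 qu]; exists (p \* q).
    split=> [x|x|x ux] /=; first by apply: continuousM; [exact: cp | exact: cq].
      have /andP[p0 p1] := p01 x; have /andP[q0 q1] := q01 x.
      by rewrite mulr_ge0//= mulr_ile1.
    by rewrite pu// qu// mulr1.
  move=> r [Sr rpq]; split; split=> // x; apply: (le_trans (rpq x)) => /=.
    have /andP[p0 p1] := p01 x; have /andP[q0 q1] := q01 x.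
    by rewrite ler_piMr.
  have /andP[p0 p1] := p01 x; have /andP[q0 q1] := q01 x.
  by rewrite ler_piMl.
have [p [cp p01 pu] pK] : (\forall p \near filter_from S B, K `<=` [set x | p x < 2^-1]).
  move/compact_near_coveringP : cK; apply => x Kx.
  have /(@uniform_separatorP _ R)[q [cq q01 qx qu]] : uniform_separator [set x] (~` u).
    by apply: crX; [exact: open_closedC | move=> /(_ (Ku _ Kx))].
  have qx0 : q x = 0 by apply: qx; exists x.
  have qnear : \forall x' \near x, q x' < 2^-1.
    have : q @ x --> q x by exact: cq.
    rewrite qx0 => /(_ [set y | y < 2^-1]); apply.
    by apply: lt_nbhsl; rewrite invr_gt0.
  have Sq : S q.
    split=> // y; last by move=> uy; apply: qu; exists y.
    by have := q01 (q y) (imageT _ _); rewrite /= in_itv.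
  exists ([set x' | q x' < 2^-1], B q) => /=; first by split=> //; exists q.
  by move=> [y r] /= [qy [_ rq]]; exact: le_lt_trans qy.
have {}pK x : K x -> p x < 2^-1.
  move=> Kx; apply: pK Kx; split => //.
pose q x := p x + p x - 1.
have cq : continuous q.
  by move=> x; apply: cvgB; [apply: cvgD; exact: cp | exact: cvg_cst].
exists (q \max cst 0) => [x|].
  by apply: continuous_max; [exact: cq | exact: cvg_cst].
split=> x /= => [/pK px|/pu pux]; last by rewrite /q pux addrK; apply: max_l.
apply: max_r; rewrite subr_le0 -mulr2n -mulr_natr.
by rewrite -ler_pdivlMr// mul1r ltW.
Qed.

End Ck.

(** * Strategies on the function space *)

Section k_covers_Ck.
Context {R : realType} {X : topologicalType}.
Implicit Types f g : Ck R X.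
Local Open Scope ring_scope.

(** Any function can be changed into such a function without changing it on a given
compact set: interpolate between it and [c] inside an element of [U]
containing that set. *)
Lemma dense_eq_off_k_cover (U : set (set X)) (c : R) :
  completely_regular_space X -> k_covers X U ->
  dense [set f : Ck R X | exists2 u, U u & forall x, ~ u x -> f x = c].
Proof.
move=> crX /k_coversP[_ [oU cU]]; apply/dense_closureP => g.
apply/Ck_closureP => K e cK e0; have [u Uu Ku] := cU K cK.
have [p cp [p0 p1]] :=
  @completely_regular_compact_separation R _ _ _ crX cK (oU _ Uu) Ku.
have cf : continuous (fun x => g x + p x * (c - g x)).
  have cg := @cts_fun _ _ (g : continuousType X R).
  move=> x; apply: cvgD; first exact: cg.
  apply: cvgM; first exact: cp.
  by apply: cvgB; [exact: cvg_cst | exact: cg].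
have fE x : (mkcts cf : Ck R X) x = g x + p x * (c - g x) by [].
exists (mkcts cf : Ck R X).
  by exists u => // x /p1 px; rewrite fE px mul1r addrC subrK.
by move=> x /p0 px; rewrite fE px mul0r addr0 subrr normr0.
Qed.

Lemma not_k_covers_range (U : nat -> set (set X)) (u : nat -> set X) :
  (forall n, k_covers X (U n)) -> (forall n, U n (u n)) ->
  ~ k_covers X (range u) -> exists2 K, compact K & forall n, ~ K `<=` u n.
Proof.
move=> kU uU nku; apply: contrapT => /forall2NP nK; apply: nku.
apply/k_coversP; split=> [[n _ uT]|].
  by have /k_coversP[+ _] := kU n; apply; rewrite -uT.
split=> [_ [n _ <-]|K cK].
  by have /k_coversP[_ [+ _]] := kU n; apply.
have [//|/existsNP[n /contrapT Ku]] := nK K.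
by exists (u n) => //; exists n.
Qed.

Lemma Ck_bounded_on_compact f (K : set X) : compact K ->
  exists N : nat, forall x, K x -> `|f x| < N%:R.
Proof.
move/compact_near_coveringP => cK.
have [|N _ fN] := cK nat \oo (fun n x => `|f x| < n%:R) _.
  move=> x Kx; have cf := @cts_fun _ _ (f : continuousType X R) x.
  have fnear : \forall x' \near x, `|f x'| < `|f x| + 1.
    have : `|f x'| @[x' --> x] --> `|f x| by apply: cvg_norm; exact: cf.
    by move/(_ [set y | y < `|f x| + 1]); apply; apply: lt_nbhsl; rewrite ltrDl.
  exists ([set x' | `|f x'| < `|f x| + 1], [set n : nat | `|f x| + 1 < n%:R]).
    by split=> //; exact: nbhs_infty_gtr.
  by move=> [y n] /= [fy ny]; exact: lt_trans ny.
by exists N => x; apply: fN => /=.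
Qed.

(** No function is within 1, uniformly on [K], of more than finitely many terms of
the sequence, because it is bounded on [K]. *)
Lemma escaping_sequence (b : nat -> Ck R X) (K : set X) : compact K ->
  (forall n, exists2 x, K x & b n x = n.+1%:R) ->
  ~ closure (range b) (Ck0 R X) /\ closed_discrete_sets (Ck R X) (range b).
Proof.
move=> cK bK; split.
  move=> /Ck_closureP /(_ K 1 cK ltr01)[_ [n _ <-]].
  have [x Kx bx] := bK n => /(_ x Kx); rewrite bx /= /cst sub0r normrN normr_nat.
  by rewrite ltrn1.
apply: locally_finite_closed_discrete => [|f]; first exact: Ck_accessible.
have [N fN] := Ck_bounded_on_compact f cK.
exists [set g : Ck R X | forall x, K x -> `|f x - g x| < 1].
  by apply/Ck_nbhsP; exists K, 1; split.
apply: (@sub_finite_set _ _ (b @` `I_N)); last exact/finite_image/finite_II.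
move=> g [fg [n _ bg]]; exists n => //=; have [x Kx bx] := bK n.
have := fg x Kx; rewrite -bg bx => fn.
rewrite -ltnS -(ltr_nat R) -[N.+1%:R]natr1 -(normr_nat R n.+1) -[X in `|X|](subKr (f x)).
by apply: le_lt_trans (ler_normB _ _) _; apply: ltrD => //; exact: fN.
Qed.

(** In round [n] a function is read as the open set of all [K] on which it is
smaller than 1/(n+1) in absolute value.  A set clustering at 0 thus becomes an
open cover, possibly a trivial one, which the Rothberger game allows. *)
Lemma rothberger_compacts_fan : rothberger (compacts X) ->
  ~ one_wins (clusters_at (Ck0 R X)) (clusters_at (Ck0 R X)).
Proof.
move=> roth [s [s0 sW]].
pose small n (f : Ck R X) := [set x : X | `|f x| < n.+1%:R^-1].
have [h|b [bs bc]] :=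
  rothberger_play (s := s) (phi := fun h f => contained (small (size h) f)) roth.
  split=> [_ [f _ <-]|[K cK]].
    apply: open_contained; have cf := @cts_fun _ _ (f : continuousType X R).
    apply: (@open_comp _ _ (fun x => `|f x|) [set y | y < (size h).+1%:R^-1]).
      by move=> x _; apply: cvg_norm; exact: cf.
    exact: open_lt.
  have /Ck_closureP /(_ K (size h).+1%:R^-1 cK) [|f sf fK] := s0 h.
    by rewrite invr_gt0.
  exists (contained (small (size h) f)); first by exists f.
  by move=> x /fK; rewrite /= /cst sub0r normrN.
apply: (sW b bs); apply/Ck_closureP => K e cK e0.
have [N _ Ne] := near_infty_natSinv_lt (PosNum e0).
have [n Nn bn] := bc (exist _ K cK) N.
exists (b n); first by exists n.
move=> x Kx; rewrite /= /cst sub0r normrN.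
by apply: lt_trans (Ne n Nn); have := bn x Kx; rewrite /= size_mkseq.
Qed.

Lemma two_wins_nbhs_one_wins_clusters (Y : topologicalType) (y : Y) :
  two_wins (open_nbhs y) (~` clusters_at y) ->
  one_wins (clusters_at y) (clusters_at y).
Proof.
apply: two_wins_dual => f fP B yB.
have yB' : open_nbhs y B° by split; [exact: open_interior | exact: yB].
exists (f B°); split; first by exists B°.
by apply: interior_subset; exact: fP.
Qed.

(** A closed set avoids a neighbourhood of each point that it does not contain, so
it is enough that 0 is never answered: delete it from One's moves. *)
Lemma two_wins_closed_discrete_clusters : [set: X] !=set0 ->
  two_wins (nonempty_opens (Ck R X)) (closed_discrete_sets (Ck R X)) ->
  two_wins (nonempty_opens (Ck R X)) (~` clusters_at (Ck0 R X)).
Proof.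
move=> X0 [t tP]; pose del (U : set (Ck R X)) := U `\ Ck0 R X.
exists (fun h => t (map del h)) => a aop.
have [|tin [tcl _]] := tP (del \o a).
  by move=> n; apply: nonempty_open_no0 => //; exact: aop.
have E n : map del (mkseq a n.+1) = mkseq (del \o a) n.+1.
  by rewrite /mkseq -map_comp.
under eq_fun do rewrite E.
split=> [n|/tcl[n _ t0]]; first by rewrite E; have [] := tin n.
by have [_ +] := tin n; rewrite t0; apply.
Qed.

End k_covers_Ck.

Section fan_tightness_Ck.
Context {R : realType} {X : topologicalType}.

(** The homogeneity of the function space, which brings a selection principle at
[f] back to one at 0. *)
Lemma S1_translate (f : Ck R X) (A A0 : set (set (Ck R X))) :
  (forall B, A B -> A0 (Ck_add (Ck_opp f) @` B)) ->
  S1 A0 (clusters_at (Ck0 R X)) -> S1 A (clusters_at f).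
Proof.
move=> AA0 S1A0 B AB; have [b [bB bcl]] := S1A0 _ (fun n => AA0 _ (AB n)).
exists (fun n => Ck_add f (b n)); split=> [n|].
  by have [g Bg <-] := bB n; rewrite Ck_addK.
have := @closure_Ck_add _ _ f _ _ bcl; rewrite -(Ck_addN f) Ck_addK.
suff -> : Ck_add f @` range b = range (fun n => Ck_add f (b n)) by [].
by rewrite image_comp.
Qed.

Lemma fan_tightness_at0 :
  S1 (clusters_at (Ck0 R X)) (clusters_at (Ck0 R X)) ->
  strong_countable_fan_tightness (Ck R X).
Proof.
move=> S10 f; apply: S1_translate S10 => B Bf.
by rewrite /clusters_at /= -(Ck_addN f); exact: closure_Ck_add.
Qed.

Lemma dense_fan_tightness_at0 :
  S1 (dense_sets (Ck R X)) (clusters_at (Ck0 R X)) ->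
  strong_countable_dense_fan_tightness (Ck R X).
Proof.
move=> S10 f; apply: S1_translate S10 => B /dense_closureP dB.
apply/dense_closureP => g; rewrite -(Ck_addK (Ck_opp f) g).
exact: closure_Ck_add.
Qed.

(** The same dense sets keep the selections away from 0 and make them closed and
discrete: [D n] consists of the functions equal to [n + 1] off an element of the
n-th k-cover. *)
Lemma k_covers_dense_strategy : completely_regular_space X ->
  one_wins_predetermined (k_covers X) (k_covers X) ->
  exists D : nat -> set (Ck R X), (forall n, dense (D n)) /\
    forall b, (forall n, D n (b n)) ->
      ~ closure (range b) (Ck0 R X) /\ closed_discrete_sets (Ck R X) (range b).
Proof.
move=> crX [U [kU nU]].
exists (fun n => [set f : Ck R X |
  exists2 u, U n u & forall x, ~ u x -> f x = n.+1%:R%R]).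
split=> [n|b bD]; first exact: dense_eq_off_k_cover.
have /choice[u uP] n : exists u, U n u /\ forall x, ~ u x -> b n x = n.+1%:R%R.
  by have [u Uu bu] := bD n; exists u.
have uU n : U n (u n) by have [] := uP n.
have [K cK nKu] := not_k_covers_range kU uU (nU u uU).
apply: (escaping_sequence cK) => n.
have /existsNP[x /not_implyP[Kx ux]] := nKu n.
by exists x => //; have [_] := uP n; apply.
Qed.

End fan_tightness_Ck.

Theorem theorem47 (R : realType) (X : topologicalType)
    (X0 : [set: X] !=set0) (tychX : tychonoff_space X) :
  [<-> (* a *) two_wins (NK X) (~` k_covers X);
       (* b *) two_wins_markov (NK X) (~` k_covers X);
       (* c *) one_wins (k_covers X) (k_covers X);
       (* d *) ~ S1 (k_covers X) (k_covers X);
               one_wins_predetermined (k_covers X) (k_covers X);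
       (* e *) one_wins (clusters_at (Ck0 R X)) (clusters_at (Ck0 R X));
       (* f *) ~ strong_countable_fan_tightness (Ck R X);
               one_wins_predetermined
                 (clusters_at (Ck0 R X)) (clusters_at (Ck0 R X));
       (* g *) one_wins (dense_sets (Ck R X)) (clusters_at (Ck0 R X));
       (* h *) ~ strong_countable_dense_fan_tightness (Ck R X);
               one_wins_predetermined
                 (dense_sets (Ck R X)) (clusters_at (Ck0 R X));
       (* i *) two_wins (open_nbhs (Ck0 R X)) (~` clusters_at (Ck0 R X));
       (* j *) two_wins_markov
                 (open_nbhs (Ck0 R X)) (~` clusters_at (Ck0 R X));
       (* k *) two_wins (nonempty_opens (Ck R X)) (~` clusters_at (Ck0 R X));
       (* l *) two_wins_markov
                 (nonempty_opens (Ck R X)) (~` clusters_at (Ck0 R X));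
       (* m *) two_wins
                 (nonempty_opens (Ck R X)) (closed_discrete_sets (Ck R X));
       (* n *) two_wins_markov
                 (nonempty_opens (Ck R X)) (closed_discrete_sets (Ck R X))].
Proof.
have [/hausdorff_accessible T1 crX] := tychX.
pose C0 := clusters_at (Ck0 R X); pose N := ~ S1 (k_covers X) (k_covers X).
have denseC0 : dense_sets (Ck R X) `<=` C0 by move=> D /dense_closureP; exact.
have nbhsT : open_nbhs (Ck0 R X) `<=` nonempty_opens (Ck R X).
  by move=> U [oU U0]; split=> //; exists (Ck0 R X).
have openT0 : nonempty_opens (Ck R X) !=set0.
  by exists setT; split; [exact: openT | exists (Ck0 R X)].
have dense_meets U D : nonempty_opens (Ck R X) U -> dense_sets (Ck R X) D ->
    U `&` D !=set0 by move=> [oU U0]; exact.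
(* Each property implies N, by way of a strategy of One or Two with perfect
   information. *)
have rothN : ~ rothberger (compacts X) -> N.
  by apply: contra_not; exact: S1_rothberger_compacts.
have cN : one_wins (k_covers X) (k_covers X) -> N.
  by move=> c; apply: rothN => /rothberger_compacts_k_covers; exact.
have eN : one_wins C0 C0 -> N.
  by move=> e; apply: rothN => /(rothberger_compacts_fan (R := R)); exact.
have aN : two_wins (NK X) (~` k_covers X) -> N.
  by move=> /(two_wins_NK_one_wins_k_covers X0); exact: cN.
have gN : one_wins (dense_sets (Ck R X)) C0 -> N.
  by move=> /(one_winsS denseC0); exact: eN.
have f2N : one_wins_predetermined C0 C0 -> N.
  by move=> /predetermined_one_wins; exact: eN.
have h2N : one_wins_predetermined (dense_sets (Ck R X)) C0 -> N.
  by move=> /predetermined_one_wins; exact: gN.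
have iN : two_wins (open_nbhs (Ck0 R X)) (~` C0) -> N.
  by move=> /two_wins_nbhs_one_wins_clusters; exact: eN.
have kN : two_wins (nonempty_opens (Ck R X)) (~` C0) -> N.
  by move=> /(two_winsS nbhsT); exact: iN.
have mN : two_wins (nonempty_opens (Ck R X)) (closed_discrete_sets (Ck R X)) -> N.
  by move=> /(two_wins_closed_discrete_clusters X0); exact: kN.
(* N implies each property, by way of a predetermined or Markov strategy. *)
have Nd : N -> one_wins_predetermined (k_covers X) (k_covers X) by move/not_S1P.
have Nb : N -> two_wins_markov (NK X) (~` k_covers X).
  by move=> /Nd; exact: k_covers_markov_NK.
have Nh2 : N -> one_wins_predetermined (dense_sets (Ck R X)) C0.
  move=> /Nd /(k_covers_dense_strategy (R := R) crX)[D [dD nD]].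
  by exists D; split=> // b /nD[].
have Nf2 : N -> one_wins_predetermined C0 C0.
  by move=> /Nh2; exact: one_wins_predeterminedS.
have Nl : N -> two_wins_markov (nonempty_opens (Ck R X)) (~` C0).
  by move=> /Nh2 h2; apply: one_wins_predetermined_dual dense_meets _ => //; rewrite setCK.
have Nn : N -> two_wins_markov (nonempty_opens (Ck R X)) (closed_discrete_sets (Ck R X)).
  move=> /Nd /(k_covers_dense_strategy (R := R) crX)[D [dD nD]].
  apply: one_wins_predetermined_dual dense_meets _ => //.
  by exists D; split=> // b /nD[_ cdb]; apply.
tfae.
- by move/aN/Nb.
- by move/markov_two_wins/aN/Nd/predetermined_one_wins.
- exact: cN.
- exact: Nd.
- by move/not_S1P/Nf2/predetermined_one_wins.
- by move/eN/Nf2/not_S1P => nS1 /(_ (Ck0 R X)).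
- by move=> nS1; apply/not_S1P => /fan_tightness_at0.
- by move/f2N/Nh2/predetermined_one_wins.
- by move/gN/Nh2/not_S1P => nS1 /(_ (Ck0 R X)).
- by move=> nS1; apply/not_S1P => /dense_fan_tightness_at0.
- by move/h2N/Nl/(two_wins_markovS nbhsT)/markov_two_wins.
- by move/iN/Nl/(two_wins_markovS nbhsT).
- by move/markov_two_wins/iN/Nl/markov_two_wins.
- by move/kN/Nl.
- by move/markov_two_wins/kN/Nn/markov_two_wins.
- by move/mN/Nn.
- by move/markov_two_wins/mN/Nb/markov_two_wins.
Qed.
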